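(* Let $p$ be an odd prime. For $n\in\mathbb{N}=\{0,1,2,\dots\}$ let $$D_n=\sum_{k=0}^n\binom nk\binom{n+k}k \quad\text{and}\quad D_n(x)=\sum_{k=0}^n\binom nk\binom{n+k}kx^k.$$ Then $$\sum_{k=1}^{p-1}\frac{D_k}{k^2}\equiv 2\left(\frac{-1}p\right)E_{p-3}\pmod p$$ and $$\sum_{k=1}^{p-1}\frac{D_k}k\equiv-q_p(2)\pmod p,$$ where $q_p(2)=(2^{p-1}-1)/p$ is the Fermat quotient. Moreover, for any $p$-adic integer $x$, $$\sum_{k=1}^{p-1}\frac{D_k(x)}k\equiv\frac{(-1+\sqrt{-x})^p+(-1-\sqrt{-x})^p+2}p\pmod p.$$
   Context: $\left(\frac{\cdot}{p}\right)$ denotes the Legendre symbol. The Euler numbers $E_0,E_1,E_2,\dots$ are the integers defined by $E_0=1$ and $\sum_{0\le k\le n,\ 2\mid k}\binom nk E_{n-k}=0$ for $n=1,2,3,\dots$. Congruences between rational numbers (or $p$-adic numbers) modulo $p$ are understood in the ring of $p$-adic integers (all denominators involved are prime to $p$). The expression $\frac{(-1+\sqrt{-x})^p+(-1-\sqrt{-x})^p+2}{p}$ equals $\frac{2}{p}\sum_{j=1}^{(p-1)/2}\binom{p}{2j}(-1)^{p-2j}(-x)^{j}$, a $p$-adic integer. *)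

(* Defs.v *)
From HB Require Import structures.
From mathcomp Require Import all_boot all_order all_algebra all_field.
From mathcomp Require Import boolp.
Set Implicit Arguments.
Unset Strict Implicit.
Unset Printing Implicit Defensive.
Import Order.TTheory GRing.Theory Num.Theory.
Local Open Scope ring_scope.

(* The ring Z_p as the inverse limit of the Z/p^n. The n-th component is the  *)
(* canonical representative, in {0, ..., p^n - 1}, of the residue mod p^n:    *)
(* the condition forces both this range and the compatibility of components.  *)
(* The proof that p is prime is a parameter so that the structure of integral *)
(* domain can be inferred from the type.                                      *)
Record padic_int (p : nat) (p_pr : prime p) := PadicInt {
  padic_res :> nat -> int;
  padic_res_coherent :
    forall n, padic_res n = (padic_res n.+1 %% (p ^ n)%N%:Z)%Z }.

Section PadicRing.
Variables (p : nat) (p_pr : prime p).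
Local Notation Zp := (padic_int p_pr).
Local Notation q n := ((p ^ n)%N%:Z).

HB.instance Definition _ := gen_eqMixin Zp.
HB.instance Definition _ := gen_choiceMixin Zp.

Lemma padic_int_eq (x y : Zp) : (forall n, x n = y n) -> x = y.
Proof.
case: x y => [f Hf] [g Hg] /= /funext Hfg.
by subst g; congr PadicInt; apply: Prop_irrelevance.
Qed.

Lemma padic_res_mod (x : Zp) n : (x n %% q n)%Z = x n.
Proof. by rewrite padic_res_coherent modz_mod. Qed.

Lemma padic_modS (a : int) n : ((a %% q n.+1)%Z %% q n)%Z = (a %% q n)%Z.
Proof.
by rewrite {2}(divz_eq a (q n.+1)) expnS PoszM mulrA modzMDl.
Qed.

Lemma padic_resS (x : Zp) n : (x n.+1 %% q n)%Z = x n.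
Proof. by rewrite -padic_res_coherent. Qed.

Definition padic_const (a : int) : Zp.
Proof.
by exists (fun n => (a %% q n)%Z) => n; rewrite padic_modS.
Defined.

Definition padic_add (x y : Zp) : Zp.
Proof.
exists (fun n => ((x n + y n) %% q n)%Z) => n.
by rewrite padic_modS -[RHS]modzDm !padic_resS.
Defined.

Definition padic_opp (x : Zp) : Zp.
Proof.
by exists (fun n => ((- x n) %% q n)%Z) => n; rewrite padic_modS -[RHS]modzNm padic_resS.
Defined.

Definition padic_mul (x y : Zp) : Zp.
Proof.
exists (fun n => ((x n * y n) %% q n)%Z) => n.
by rewrite padic_modS -[RHS]modzMm !padic_resS.
Defined.

Lemma padic_addA : associative padic_add.
Proof. by move=> x y z; apply: padic_int_eq => n /=; rewrite modzDml modzDmr addrA. Qed.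
Lemma padic_addC : commutative padic_add.
Proof. by move=> x y; apply: padic_int_eq => n /=; rewrite addrC. Qed.
Lemma padic_add0 : left_id (padic_const 0) padic_add.
Proof. by move=> x; apply: padic_int_eq => n /=; rewrite modzDml add0r padic_res_mod. Qed.
Lemma padic_addN : left_inverse (padic_const 0) padic_opp padic_add.
Proof. by move=> x; apply: padic_int_eq => n /=; rewrite modzDml addNr. Qed.

HB.instance Definition _ :=
  GRing.isZmodule.Build Zp padic_addA padic_addC padic_add0 padic_addN.

Lemma padic_mulA : associative padic_mul.
Proof. by move=> x y z; apply: padic_int_eq => n /=; rewrite modzMml modzMmr mulrA. Qed.
Lemma padic_mulC : commutative padic_mul.
Proof. by move=> x y; apply: padic_int_eq => n /=; rewrite mulrC. Qed.
Lemma padic_mul1 : left_id (padic_const 1) padic_mul.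
Proof. by move=> x; apply: padic_int_eq => n /=; rewrite modzMml mul1r padic_res_mod. Qed.
Lemma padic_mulDl : left_distributive padic_mul padic_add.
Proof.
move=> x y z; apply: padic_int_eq => n /=.
by rewrite modzMml modzDml modzDmr mulrDl.
Qed.
Lemma padic_1neq0 : padic_const 1 != 0.
Proof.
apply/eqP => /(congr1 (fun x : Zp => x 1%N)) /=.
by rewrite expn1 mod0z modz_small //= ltz_nat prime_gt1.
Qed.

HB.instance Definition _ := GRing.Zmodule_isComNzRing.Build Zp
  padic_mulA padic_mulC padic_mul1 padic_mulDl padic_1neq0.

Definition padic_unit : {pred Zp} := fun x => `[< exists y, y * x = 1 >].
Definition padic_inv (x : Zp) : Zp :=
  if pselect (exists y, y * x = 1) is left e then projT1 (cid e) else x.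

Lemma padic_mulVx : {in padic_unit, left_inverse 1 padic_inv *%R}.
Proof.
move=> x; rewrite unfold_in => /asboolP ux; rewrite /padic_inv.
by case: pselect => // e; case: cid.
Qed.
Lemma padic_unitP (x y : Zp) : y * x = 1 -> padic_unit x.
Proof. by move=> yx; apply/asboolP; exists y. Qed.
Lemma padic_inv_out : {in [predC padic_unit], padic_inv =1 id}.
Proof.
move=> x /negP nux; rewrite /padic_inv; case: pselect => // ux.
by case: nux; rewrite unfold_in; apply/asboolP.
Qed.

HB.instance Definition _ := GRing.ComNzRing_hasMulInverse.Build Zp
  padic_mulVx padic_unitP padic_inv_out.

Lemma padic_res_addn (x : Zp) m k : (x (m + k)%N %% q m)%Z = x m.
Proof.
elim: k => [|k IHk]; first by rewrite addn0 padic_res_mod.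
rewrite -{}IHk addnS -(padic_resS x (m + k)) expnD PoszM.
set a := x _; rewrite {1}(divz_eq a (q m * q k)) [q m * _]mulrC mulrA.
by rewrite modzMDl.
Qed.

Lemma padic_neq0 (x : Zp) : x != 0 -> exists m, x m != 0.
Proof.
move=> nx0; apply: contrapT => nx; case/eqP: nx0; apply: padic_int_eq => n /=.
by rewrite mod0z; apply/eqP/contraT => xn; case: nx; exists n.
Qed.

Lemma padic_integral : GRing.integral_domain_axiom Zp.
Proof.
move=> x y xy0; apply/norP => -[/padic_neq0 [m xm] /padic_neq0 [k yk]].
have ndvd (z : Zp) i j : z i != 0 -> ~~ (q i %| z (i + j)%N)%Z.
  by move=> zi; apply: contra zi => /dvdz_mod0P; rewrite padic_res_addn => ->.
have /(congr1 (fun z : Zp => z (m + k)%N)) /= := xy0.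
rewrite mod0z => /dvdz_mod0P xyd.
have := ndvd x m k xm; have := ndvd y k m yk; rewrite [(k + m)%N]addnC.
move: xyd; rewrite !dvdzE abszM /=.
set a := `|x _|%N; set b := `|y _|%N => xyd nb na.
have a0 : (0 < a)%N by rewrite lt0n; apply: contraNneq na => ->; rewrite dvdn0.
have b0 : (0 < b)%N by rewrite lt0n; apply: contraNneq nb => ->; rewrite dvdn0.
move: xyd na nb; rewrite !pfactor_dvdn ?muln_gt0 ?a0 // lognM // -!ltnNge.
by move=> le1 lt1 lt2; move: (leq_ltn_trans le1 (leq_add lt1 (ltnW lt2))); rewrite ltnn.
Qed.
HB.instance Definition _ := GRing.ComUnitRing_isIntegral.Build Zp padic_integral.

End PadicRing.

Notation "x %:F" := (FracField.tofrac x) : ring_scope.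

Notation padic_num p_pr := {fraction padic_int p_pr}.

(* Congruence mod p in Z_p between two p-adic numbers; in particular both     *)
(* sides are required to be p-adic integers.                                  *)
Definition padic_eqmod (p : nat) (p_pr : prime p) (a b : padic_num p_pr) : Prop :=
  exists u v w : padic_int p_pr, [/\ a = u%:F, b = v%:F & u - v = p%:R * w].
Arguments padic_eqmod {p} p_pr a b.

(* Every element of a field, in particular -x in Q_p, has a square root in    *)
(* some extension field.                                                      *)
Lemma sqrt_extension (F : fieldType) (a : F) :
  exists (L : fieldType) (iota : {rmorphism F -> L}) (s : L), s ^+ 2 = iota a.
Proof.
have [[s sa]|nsq] := pselect (exists s : F, s ^+ 2 = a).
  by exists F, idfun, s.
have sz : size ('X^2 - a%:P) = 3.
  by rewrite size_polyDl size_polyXn // size_polyN (leq_ltn_trans (size_polyC_leq1 _)).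
have irr : irreducible_poly ('X^2 - a%:P).
  apply: cubic_irreducible => [|s]; first by rewrite sz.
  apply/negP => /rootP; rewrite !hornerE => /eqP.
  by rewrite subr_eq0 => /eqP sa; apply: nsq; exists s.
have [L _ [s /rootP rs _]] := irredp_FAdjoin irr.
exists L, (in_alg L), s; apply/eqP; rewrite -subr_eq0; apply/eqP.
by move: rs; rewrite rmorphB /= map_polyXn map_polyC /= !hornerE.
Qed.

Definition legendre (a : int) (p : nat) : int :=
  if (p%:Z %| a)%Z then 0
  else if [exists b : 'I_p, (b%:Z ^+ 2 == a %[mod p%:Z])%Z] then 1 else -1.

(* euler_seq n = [:: E_0; ...; E_n] *)
Fixpoint euler_seq (n : nat) : seq int :=
  if n is m.+1 then
    rcons (euler_seq m)
      (- \sum_(1 <= k < m.+2 | ~~ odd k)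
          'C(m.+1, k)%:R * (euler_seq m)`_(m.+1 - k))
  else [:: 1].

Definition euler (n : nat) : int := (euler_seq n)`_n.

Lemma size_euler_seq n : size (euler_seq n) = n.+1.
Proof. by elim: n => //= n IHn; rewrite size_rcons IHn. Qed.

Lemma nth_euler_seq m n : (n <= m)%N -> (euler_seq m)`_n = euler n.
Proof.
elim: m => [|m IHm]; first by rewrite leqn0 => /eqP ->.
rewrite leq_eqVlt => /predU1P[-> //|ltnm].
by rewrite /= nth_rcons size_euler_seq ltnm IHm.
Qed.

Lemma euler0 : euler 0 = 1.
Proof. by []. Qed.

Lemma euler_rec n : (0 < n)%N ->
  \sum_(0 <= k < n.+1 | ~~ odd k) 'C(n, k)%:R * euler (n - k) = 0.
Proof.
case: n => // n _; rewrite big_mkcond big_nat_recl //= bin0 mul1r subn0.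
rewrite {1}/euler /= nth_rcons size_euler_seq ltnn eqxx.
rewrite [in X in - X]big_mkcond big_add1 /=.
under eq_big_nat => k /andP[_ ltk].
  rewrite nth_euler_seq; last by rewrite subSS leq_subr.
  over.
by rewrite addNr.
Qed.

Definition delannoy (n : nat) : nat :=
  (\sum_(0 <= k < n.+1) 'C(n, k) * 'C(n + k, k))%N.

Definition delannoy_poly (R : pzRingType) (n : nat) (x : R) : R :=
  \sum_(0 <= k < n.+1) ('C(n, k) * 'C(n + k, k))%:R * x ^+ k.

(* Main.v *)
From HB Require Import structures.
Require Import Defs.
From mathcomp Require Import all_boot all_order all_algebra all_field.
From mathcomp Require Import zify ring.
Set Implicit Arguments.
Unset Strict Implicit.
Unset Printing Implicit Defensive.
Import Order.TTheory GRing.Theory Num.Theory.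
Local Open Scope ring_scope.

(* Let N = (p - 1)/2 and P_j(k) = prod_(0 < i < j) (k^2 - i^2).  From            *)
(*   C(k,j) C(k+j,j) j!^2 = k (k + j) P_j(k)                                     *)
(* the coefficient of x^j in sum_k D_k(x)/k is sum_k (k + j) P_j(k) / j!^2.      *)
(* Modulo p the part odd in k cancels under k -> p - k; the sum of P_j over the  *)
(* whole field vanishes when deg P_j < p - 1, so that only -P_j(0) survives, and *)
(* P_j vanishes at every nonzero k when j > N.  Hence, modulo p,                 *)
(*   sum_k D_k(x)/k = sum_(j <= N) (-x)^j/j,                                     *)
(*   sum_k D_k/k^2 = sum_(j <= N) (-1)^j/j^2   (p > 3; p = 3 is computed).       *)
(* The first sum is matched with the binomial expansion of (-1 +- sqrt(-x))^p    *)
(* through C(p,2j)/p = -1/(2j).  At x = 1 the sum of the two conjugate powers    *)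
(* is -2e with e = +-2^N, so y := 2(1 - e)/p is a p-adic integer and             *)
(* -(e^2 - 1)/p = y - p y^2/4.  For the last alternating sum, the polynomial     *)
(* F(t) = sum_k C(m,k) E_k t^(m-k) with m = p - 3 satisfies                      *)
(* F(t+1) + F(t-1) = 2 t^m, so the sum telescopes to (-1)^N F(p) - F(1), where   *)
(* F(p) = E_m modulo p and F(1) = 0.                                             *)

(** All three congruences are decided in ['F_p]: reduction Z_p -> F_p is a ring morphism with kernel
    p Z_p ([padic_red_eq0]) and the denominators k < p are units, so equal reductions suffice
    ([padic_eqmod_red]). The key evaluation there is [sum_sqprod_Fp], which turns both Delannoy sums
    into short sums over j <= (p - 1)/2. [bin_div_Fp] and [conj_pow_sum] identify the polynomial
    sum, [gauss_pow_sum] specializes it at x = 1, and [euler_umbra_alternating] brings in the Euler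
    number. *)

Section PadicReduction.
Variables (p : nat) (p_pr : prime p).
Local Notation Zp := (padic_int p_pr).

Lemma padic_res_nat (k n : nat) : (k%:R : Zp) n = (k%:Z %% (p ^ n)%N%:Z)%Z.
Proof.
elim: k => [|k IHk]; first by [].
by rewrite mulrS /= IHk modzDm; congr (modz _ _); lia.
Qed.

Lemma padic_res_range (x : Zp) n : 0 <= x n < (p ^ n)%N%:Z.
Proof.
have pn0 : (0 < p ^ n)%N by rewrite expn_gt0 prime_gt0.
rewrite -padic_res_mod modz_ge0 ?ltz_mod //; lia.
Qed.

Definition padic_red (x : Zp) : 'F_p := (x 1%N)%:~R.

Lemma intr_Fp_mod (a : int) : ((a %% p%:Z)%Z%:~R : 'F_p) = a%:~R.
Proof.
rewrite /modz intrB intrM -[p%:~R]/(p%:R).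
by rewrite pchar_Fp_0 // mulr0 subr0.
Qed.

Lemma padic_red_is_zmod_morphism : zmod_morphism padic_red.
Proof.
move=> x y; rewrite /padic_red /= !expn1 intr_Fp_mod rmorphD /= intr_Fp_mod.
by rewrite rmorphN.
Qed.

Lemma padic_red_is_monoid_morphism : monoid_morphism padic_red.
Proof.
split=> [|x y]; rewrite /padic_red /= !expn1 intr_Fp_mod //.
by rewrite rmorphM.
Qed.

HB.instance Definition _ :=
  GRing.isZmodMorphism.Build Zp 'F_p padic_red padic_red_is_zmod_morphism.
HB.instance Definition _ :=
  GRing.isMonoidMorphism.Build Zp 'F_p padic_red padic_red_is_monoid_morphism.

Lemma padic_red_eq0 (x : Zp) : padic_red x = 0 -> exists w, x = p%:R * w.
Proof.
move=> rx0; have p0 := prime_gt0 p_pr.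
have x1 : x 1%N = 0.
  have := padic_res_range x 1; rewrite expn1; move: rx0; rewrite /padic_red.
  case: (x 1%N) => // m /eqP; rewrite -[m%:~R]/(m%:R) -(dvdn_pcharf (pchar_Fp p_pr)).
  by case: m => // m /dvdn_leq; lia.
have dvd_x n : (p%:Z %| x n.+1)%Z.
  by apply/dvdz_mod0P; have := padic_res_addn x 1 n; rewrite add1n expn1 x1.
(* Division by p costs one digit, so component n of the quotient comes from component n + 1 of x. *)
have co n : (x n.+1 %/ p%:Z)%Z = ((x n.+2 %/ p%:Z)%Z %% (p ^ n)%N%:Z)%Z.
  have := padic_res_coherent x n.+1.
  move: (dvd_x n) (dvd_x n.+1) => /dvdzP[a ->] /dvdzP[b ->].
  rewrite !mulzK; try lia.
  rewrite expnSr PoszM -mulz_modl; last lia.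
  by apply: mulIf; lia.
exists (PadicInt p_pr co); apply: padic_int_eq => n /=.
rewrite padic_res_nat modzMml mulrC divzK; last by [].
by rewrite -padic_res_coherent.
Qed.

(** Bezout gives an inverse modulo each p^n; the independent choices cohere because inverses are
    unique modulo p^n. *)
Lemma padic_natr_unit (k : nat) : ~~ (p %| k)%N -> (k%:R : Zp) \is a GRing.unit.
Proof.
move=> npk; have cop n : coprime k (p ^ n) by rewrite coprimeXr // coprime_sym prime_coprime.
have ex n : exists y : int, (k%:Z * y == 1 %[mod (p ^ n)%N%:Z])%Z.
  have /coprimezP[[u v] /= uv] : coprimez k%:Z (p ^ n)%N%:Z by exact: cop.
  by exists u; rewrite -uv mulrC addrC eq_sym modzMDl.
pose y n := xchoose (ex n).
have Hy n : (k%:Z * y n == 1 %[mod (p ^ n)%N%:Z])%Z by apply: xchooseP (ex n).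
have co n : (y n %% (p ^ n)%N%:Z)%Z = ((y n.+1 %% (p ^ n.+1)%N%:Z)%Z %% (p ^ n)%N%:Z)%Z.
  rewrite padic_modS; apply/eqP; rewrite eqz_mod_dvd.
  rewrite -(@Gauss_dvdzr _ k%:Z); last by rewrite coprimez_sym; exact: cop.
  rewrite mulrBr -eqz_mod_dvd (eqP (Hy n)) eq_sym -padic_modS (eqP (Hy n.+1)).
  by rewrite padic_modS.
apply/unitrPr; exists (PadicInt p_pr co); apply: padic_int_eq => n /=.
by rewrite padic_res_nat modzMm; apply/eqP/Hy.
Qed.

Lemma padic_p_neq0 : (p%:R : Zp) != 0.
Proof.
apply/eqP => /(congr1 (fun z : Zp => z 2%N)); rewrite padic_res_nat /= mod0z.
by rewrite modz_nat modn_small ?ltn_Pmull ?prime_gt1 ?prime_gt0 //; have := prime_gt0 p_pr; lia.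
Qed.

Lemma padic_eqmod_red (u v : Zp) :
  padic_red u = padic_red v -> padic_eqmod p_pr u%:F v%:F.
Proof.
move=> uv; have [|w uvw] := @padic_red_eq0 (u - v); first by rewrite rmorphB /= uv subrr.
by exists u, v, w.
Qed.

End PadicReduction.

(** * Sums of polynomial values over finite fields *)

Section FinFieldSums.
Variable F : finFieldType.

(** ['X^m - 1] has at most m roots, too few to cover all nonzero elements. *)
Lemma finField_exp_neq1 m : (0 < m < #|F|.-1)%N ->
  exists2 b : F, b != 0 & b ^+ m != 1.
Proof.
case/andP=> m0 mF; apply/exists_inP/contraT; rewrite negb_exists_in => /forall_inP H.
have /max_poly_roots : ('X^m - 1 : {poly F}) != 0.
  by rewrite -size_poly_eq0 size_XnsubC.
move=> /(_ (enum (predC1 (0 : F)))); rewrite enum_uniq size_XnsubC // -cardE cardC1.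
rewrite ltnS leqNgt mF => H'.
suff /H' : all (root ('X^m - 1)) (enum (predC1 (0 : F))) by move=> /(_ isT).
apply/allP => a; rewrite mem_enum => /H; rewrite negbK => /eqP am.
by rewrite rootE !hornerE am subrr.
Qed.

Lemma natr_card_finField : #|F|%:R = 0 :> F.
Proof.
have : \sum_(a : F) a = \sum_(a : F) (a + 1).
  by rewrite (reindex_inj (addIr 1)).
rewrite big_split /= sumr_const => /eqP.
by rewrite -[X in X == _]addr0 (inj_eq (addrI _)) eq_sym => /eqP.
Qed.

Lemma sum_finField_exp m : (m < #|F|.-1)%N -> \sum_(a : F) a ^+ m = 0.
Proof.
case: m => [|m] mF; first by rewrite sumr_const natr_card_finField.
have [//|b b0 bm] := @finField_exp_neq1 m.+1.
(* Multiplication by b permutes F, so the sum is fixed by a factor other than 1 and must vanish. *)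
have : \sum_(a : F) a ^+ m.+1 = b ^+ m.+1 * \sum_(a : F) a ^+ m.+1.
  rewrite [LHS](reindex_inj (mulfI b0)) mulr_sumr /=.
  by apply: eq_bigr => a _; rewrite exprMn.
move/eqP; rewrite -subr_eq0 -{1}[X in X - _]mul1r -mulrBl mulf_eq0 subr_eq0 eq_sym.
by rewrite (negPf bm) => /eqP.
Qed.

Lemma sum_finField_horner (q : {poly F}) :
  (size q <= #|F|.-1)%N -> \sum_(a : F) q.[a] = 0.
Proof.
move=> szq; under eq_bigr do rewrite horner_coef.
rewrite exchange_big big1 //= => i _.
by rewrite -mulr_sumr sum_finField_exp ?mulr0 // (leq_trans (ltn_ord i)).
Qed.

End FinFieldSums.

Section PrimeField.
Variables (p : nat) (p_pr : prime p).

Lemma natr_Fp_eq0 k : ((k%:R : 'F_p) == 0) = (p %| k)%N.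
Proof. by rewrite -(dvdn_pcharf (pchar_Fp p_pr)). Qed.

Lemma natr_Fp_neq0 k : (0 < k < p)%N -> (k%:R : 'F_p) != 0.
Proof. by move=> /andP[k0 kp]; rewrite natr_Fp_eq0 gtnNdvd. Qed.

Lemma fact_Fp_neq0 j : (j < p)%N -> (j`!%:R : 'F_p) != 0.
Proof.
elim: j => [|j IHj] jp; first by rewrite oner_eq0.
by rewrite factS natrM mulf_neq0 ?IHj ?natr_Fp_neq0 // ltnW.
Qed.

Lemma sum_Fp_nat (g : 'F_p -> 'F_p) :
  \sum_(0 <= k < p) g k%:R = \sum_(a : 'F_p) g a.
Proof.
rewrite big_mkord (reindex (fun i : 'I_p => (i : nat)%:R : 'F_p)) //=.
apply: onW_bij; apply: inj_card_bij; last by rewrite card_Fp // card_ord.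
move=> i j /(congr1 (fun a : 'F_p => a : nat)).
by rewrite !val_Fp_nat // !modn_small //; apply: val_inj.
Qed.

Lemma sum_Fp_units_horner (q : {poly 'F_p}) : (size q < p)%N ->
  \sum_(1 <= k < p) q.[k%:R] = - q.[0].
Proof.
move=> szq; apply/eqP; rewrite -addr_eq0 addrC.
have := sum_Fp_nat (horner q); rewrite big_ltn ?prime_gt0 // => ->.
by rewrite sum_finField_horner ?card_Fp // -ltnS prednK ?prime_gt0.
Qed.

Lemma natrB_Fp k : (k <= p)%N -> ((p - k)%:R : 'F_p) = - k%:R.
Proof. by move=> kp; rewrite natrB // pchar_Fp_0 // sub0r. Qed.

Hypothesis p_odd : odd p.

Lemma Fp_2neq0 : (2 : 'F_p) != 0.
Proof. by apply: natr_Fp_neq0; have := prime_gt1 p_pr; lia. Qed.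

Lemma sum_Fp_odd (g : 'F_p -> 'F_p) : (forall a, g (- a) = - g a) ->
  \sum_(1 <= k < p) g k%:R = 0.
Proof.
move=> g_odd; have : \sum_(1 <= k < p) g k%:R = - \sum_(1 <= k < p) g k%:R.
  rewrite {1}big_nat_rev -sumrN; apply: eq_big_nat => k /andP[k1 kp].
  by rewrite add1n subSS natrB_Fp ?g_odd // ltnW.
move/eqP; rewrite -addr_eq0 -mulr2n -mulr_natl mulf_eq0.
by rewrite (negPf Fp_2neq0) => /eqP.
Qed.

End PrimeField.

(** * The product P_j and the coefficients of Delannoy polynomials *)

Definition sqprod (R : pzRingType) (j : nat) (a : R) : R :=
  \prod_(1 <= i < j) (a ^+ 2 - i%:R ^+ 2).

Lemma sqprodS (R : pzRingType) j (a : R) :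
  sqprod j.+2 a = sqprod j.+1 a * (a ^+ 2 - j.+1%:R ^+ 2).
Proof. by rewrite /sqprod big_nat_recr. Qed.

Lemma sqprodN (R : pzRingType) j (a : R) : sqprod j (- a) = sqprod j a.
Proof. by rewrite /sqprod sqrrN. Qed.

(** Both sides are (k + j + 1)!/(k - j - 1)! when k > j, and 0 otherwise. Passing from j + 1 to j +
    2 multiplies each by (k - j - 1)(k + j + 2). *)
Lemma bin_bin_sqprod (R : comPzRingType) (k j : nat) :
  ('C(k, j.+1) * 'C(k + j.+1, j.+1))%:R * (j.+1)`!%:R ^+ 2
  = k%:R * (k%:R + j.+1%:R) * sqprod j.+1 (k%:R : R).
Proof.
elim: j => [|j IHj].
  by rewrite /sqprod big_geq // !bin1 factS fact0 !natrM !natrD; ring.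
have rec : (j.+2%:R ^+ 2 * ('C(k, j.+2) * 'C(k + j.+2, j.+2))%:R
   = (k%:R - j.+1%:R) * (k%:R + j.+2%:R) * ('C(k, j.+1) * 'C(k + j.+1, j.+1))%:R :> R).
  have [ltkj|lejk] := ltnP k j.+1; first by rewrite !(bin_small (n := k)) //; [ring|lia].
  rewrite -natrB // -natrD -!natrM -natrX -natrM; congr (_%:R).
  have := mul_bin_left k j.+1; have := mul_bin_diag (k + j.+2) j.+1.
  rewrite (_ : (k + j.+2).-1 = k + j.+1)%N; last lia.
  move=> e1 e2; transitivity ((j.+2 * 'C(k, j.+2)) * (j.+2 * 'C(k + j.+2, j.+2)))%N; first by ring.
  by rewrite -e1 e2; ring.
rewrite factS natrM sqprodS.
transitivity ((j.+2%:R ^+ 2 * ('C(k, j.+2) * 'C(k + j.+2, j.+2))%:R) * ((j.+1)`!%:R ^+ 2 : R)); first by ring.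
rewrite rec -[LHS]mulrA IHj; ring.
Qed.

Lemma horner_sqprodX (R : comNzRingType) j (a : R) : (sqprod j 'X).[a] = sqprod j a.
Proof.
rewrite /sqprod horner_prod; apply: eq_bigr => i _.
by rewrite -polyC_natr -polyC_exp !hornerE.
Qed.

Lemma size_sqprodX (R : comNzRingType) j : (size (sqprod j.+1 'X : {poly R}) <= (j.*2).+1)%N.
Proof.
elim: j => [|j IHj]; first by rewrite /sqprod big_geq // size_poly1.
rewrite sqprodS (leq_trans (size_polyMleq _ _)) //.
have : (size ('X^2 - j.+1%:R ^+ 2 : {poly R})%R <= 3)%N.
  by rewrite -polyC_natr -polyC_exp size_XnsubC.
by move: (size _) (size _) IHj => a b; lia.
Qed.

Lemma sqprod_at0 (R : comPzRingType) j :
  sqprod j.+1 (0 : R) = (-1) ^+ j * j`!%:R ^+ 2.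
Proof.
elim: j => [|j IHj]; first by rewrite /sqprod big_geq // expr1n mulr1.
by rewrite sqprodS IHj factS natrM [(-1) ^+ j.+1]exprS; ring.
Qed.

Lemma delannoy_natr (R : pzRingType) k : (delannoy k)%:R = delannoy_poly k (1 : R).
Proof.
by rewrite /delannoy_poly natr_sum; apply: eq_bigr => j _; rewrite expr1n mulr1.
Qed.

Lemma sum_delannoy_poly_weighted (R : comPzRingType) (w : nat -> R) n (x : R) :
  \sum_(1 <= k < n.+1) delannoy_poly k x * w k
  = \sum_(1 <= k < n.+1) w k
    + \sum_(1 <= j < n.+1)
        (\sum_(1 <= k < n.+1) ('C(k, j) * 'C(k + j, j))%:R * w k) * x ^+ j.
Proof.
transitivity (\sum_(1 <= k < n.+1) \sum_(0 <= j < n.+1)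
    ('C(k, j) * 'C(k + j, j))%:R * w k * x ^+ j).
  (* The inner range may be extended up to n since C(k,j) = 0 for j > k; the two sums then
     commute. *)
  apply: eq_big_nat => k /andP[_ kn]; rewrite [RHS](big_cat_nat (n := k.+1)) //=.
  rewrite [X in _ + X]big_nat_cond [X in _ + X]big1 ?addr0; last first.
    by move=> j /andP[/andP[kj _] _]; rewrite bin_small ?mul0n ?mul0r.
  by rewrite /delannoy_poly mulr_suml; apply: eq_bigr => j _; ring.
rewrite exchange_big /= big_ltn //; congr (_ + _).
  by apply: eq_bigr => k _; rewrite !bin0 mul1r mulr1.
by apply: eq_bigr => j _; rewrite mulr_suml.
Qed.

(** * Delannoy sums over F_p *)

Section DelannoyFp.
Variables (p : nat) (p_pr : prime p) (p_odd : odd p).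
Local Notation N := (p./2).

(** One of k and p - k is at most N, hence is an index i of the product with i^2 = k^2. *)
Lemma sqprod_Fp_eq0 j k : (0 < k < p)%N -> (N < j)%N -> sqprod j (k%:R : 'F_p) = 0.
Proof.
move=> kp Nj; apply/eqP; rewrite /sqprod prodf_seq_eq0; apply/hasP => /=.
have [kN|Nk] := leqP k N.
  by exists k; rewrite ?mem_index_iota ?subrr ?eqxx //; lia.
exists (p - k)%N; first by rewrite mem_index_iota; lia.
by rewrite natrB_Fp //; [rewrite sqrrN subrr eqxx | lia].
Qed.

(** For j <= N the degree 2(j - 1) is below p - 1, so the sum is -P_j(0) = (-1)^j (j - 1)!^2. *)
Lemma sum_sqprod_Fp j : (0 < j < p)%N ->
  (\sum_(1 <= k < p) sqprod j (k%:R : 'F_p)) / j`!%:R ^+ 2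
  = if (j <= N)%N then (-1) ^+ j / j%:R ^+ 2 else 0.
Proof.
move=> /andP[j0 jp]; case: leqP => [jN|Nj]; last first.
  rewrite big_nat big1 ?mul0r // => k kp; exact: sqprod_Fp_eq0.
case: j j0 jp jN => // j _ jp jN.
under eq_bigr do rewrite -horner_sqprodX.
rewrite sum_Fp_units_horner //; last first.
  by apply: leq_ltn_trans (size_sqprodX _ _) _; lia.
have /(fact_Fp_neq0 p_pr) jf : (j < p)%N by lia.
have /(natr_Fp_neq0 p_pr) js : (0 < j.+1 < p)%N by lia.
rewrite horner_sqprodX sqprod_at0 factS natrM [(-1) ^+ j.+1]exprS.
by field; rewrite jf nat1r js.
Qed.

Lemma sum_bin_bin_div_Fp j : (0 < j < p)%N ->
  \sum_(1 <= k < p) ('C(k, j) * 'C(k + j, j))%:R / (k%:R : 'F_p)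
  = if (j <= N)%N then (-1) ^+ j / j%:R else 0.
Proof.
move=> jp; have j0 := natr_Fp_neq0 p_pr jp.
have -> : (if (j <= N)%N then (-1) ^+ j / j%:R else 0 : 'F_p)
    = j%:R * (if (j <= N)%N then (-1) ^+ j / j%:R ^+ 2 else 0).
  by case: ifP => _; [field; rewrite j0 | rewrite mulr0].
rewrite -sum_sqprod_Fp //; case: j jp j0 => // j jp j0.
have /(fact_Fp_neq0 p_pr) jf : (j.+1 < p)%N by lia.
have odd0 : \sum_(1 <= k < p) (k%:R : 'F_p) * sqprod j.+1 k%:R = 0.
  by apply: (sum_Fp_odd p_pr p_odd (g := fun a => a * sqprod j.+1 a)) => a; rewrite sqprodN mulNr.
transitivity ((\sum_(1 <= k < p) k%:R * sqprod j.+1 k%:R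
  + j.+1%:R * \sum_(1 <= k < p) sqprod j.+1 k%:R) / ((j.+1)`!%:R ^+ 2 : 'F_p)); last first.
  by rewrite odd0 add0r mulrA.
rewrite mulr_sumr -big_split mulr_suml /=.
apply: eq_big_nat => k /(natr_Fp_neq0 p_pr) k0.
apply: (mulIf (expf_neq0 2 jf)); rewrite mulrAC bin_bin_sqprod.
by field; rewrite jf k0.
Qed.

Lemma sum_bin_bin_div2_Fp j : (0 < j < p)%N ->
  \sum_(1 <= k < p) ('C(k, j) * 'C(k + j, j))%:R / (k%:R ^+ 2 : 'F_p)
  = if (j <= N)%N then (-1) ^+ j / j%:R ^+ 2 else 0.
Proof.
move=> jp; rewrite -sum_sqprod_Fp //; case: j jp => // j jp.
have /(fact_Fp_neq0 p_pr) jf : (j.+1 < p)%N by lia.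
have odd0 : \sum_(1 <= k < p) (j.+1%:R / k%:R : 'F_p) * sqprod j.+1 k%:R = 0.
  apply: (sum_Fp_odd p_pr p_odd (g := fun a => j.+1%:R / a * sqprod j.+1 a)) => a.
  by rewrite sqprodN invrN mulrN mulNr.
transitivity ((\sum_(1 <= k < p) j.+1%:R / k%:R * sqprod j.+1 k%:R
  + \sum_(1 <= k < p) sqprod j.+1 k%:R) / ((j.+1)`!%:R ^+ 2 : 'F_p)); last first.
  by rewrite odd0 add0r.
rewrite -big_split mulr_suml /=.
apply: eq_big_nat => k /(natr_Fp_neq0 p_pr) k0.
apply: (mulIf (expf_neq0 2 jf)); rewrite mulrAC bin_bin_sqprod.
by field; rewrite jf k0.
Qed.

Lemma sum_to_half (f : nat -> 'F_p) :
  \sum_(1 <= j < p) (if (j <= N)%N then f j else 0) = \sum_(1 <= j < N.+1) f j.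
Proof.
have p1 := prime_gt1 p_pr.
rewrite (big_cat_nat (n := N.+1)) //=; [|lia].
rewrite [X in _ + X]big_nat_cond [X in _ + X]big1 ?addr0 => [|j /andP[/andP[Nj _] _]].
  by apply: eq_big_nat => j /andP[_]; rewrite ltnS => ->.
by rewrite leqNgt Nj.
Qed.

Lemma sum_delannoy_div_Fp (x : 'F_p) :
  \sum_(1 <= k < p) delannoy_poly k x / k%:R
  = \sum_(1 <= j < N.+1) (- x) ^+ j / j%:R.
Proof.
have p0 := prime_gt0 p_pr.
have := sum_delannoy_poly_weighted (fun k => k%:R^-1) p.-1 x; rewrite prednK // => ->.
rewrite (sum_Fp_odd p_pr p_odd (g := fun a => a^-1)) ?add0r; last exact: invrN.
rewrite -sum_to_half; apply: eq_big_nat => j jp; rewrite sum_bin_bin_div_Fp //.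
by case: ifP => _; [rewrite (exprNn x) mulrAC | rewrite mul0r].
Qed.

(** Fermat's little theorem; it trades inverse squares for a polynomial of degree p - 3. *)
Lemma Fp_expV2 (a : 'F_p) : a != 0 -> a ^+ (p - 3) = (a ^+ 2)^-1.
Proof.
move=> a0; have p1 := prime_gt1 p_pr; apply: (mulIf (expf_neq0 2 a0)).
rewrite mulVf ?expf_neq0 // -exprD; apply: (mulIf a0); rewrite -exprSr mul1r.
rewrite (_ : (p - 3 + 2).+1 = p)%N; last lia.
by have := expf_card a; rewrite card_Fp.
Qed.

Lemma sum_Fp_inv2 : (3 < p)%N -> \sum_(1 <= k < p) (k%:R ^+ 2 : 'F_p)^-1 = 0.
Proof.
move=> p3; rewrite (eq_big_nat _ _ (F2 := fun k => ('X^(p - 3)).[k%:R])); last first.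
  by move=> k /(natr_Fp_neq0 p_pr) k0; rewrite hornerXn Fp_expV2.
rewrite sum_Fp_units_horner ?size_polyXn //; last lia.
by rewrite hornerXn expr0n subn_eq0 leqNgt p3 oppr0.
Qed.

Lemma sum_delannoy_div2_Fp : (3 < p)%N ->
  \sum_(1 <= k < p) (delannoy k)%:R / (k%:R ^+ 2 : 'F_p)
  = \sum_(1 <= j < N.+1) (-1) ^+ j / j%:R ^+ 2.
Proof.
move=> p3; under eq_bigr do rewrite delannoy_natr.
have := sum_delannoy_poly_weighted (fun k => (k%:R ^+ 2)^-1) p.-1 (1 : 'F_p).
rewrite prednK ?prime_gt0 // => ->; rewrite sum_Fp_inv2 // add0r -sum_to_half.
apply: eq_big_nat => j jp; rewrite sum_bin_bin_div2_Fp // expr1n mulr1.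
by case: ifP.
Qed.

End DelannoyFp.

(** * Euler numbers and their umbral calculus *)

Lemma euler_odd n : odd n -> euler n = 0.
Proof.
elim/ltn_ind: n => n IHn n_odd; have n0 : (0 < n)%N by case: n n_odd {IHn}.
have := euler_rec n0; rewrite big_mkcond big_ltn //= bin0 subn0 mul1r.
rewrite big_nat big1 ?addr0 // => k /andP[k0 kn]; case: ifP => // k_even.
by rewrite IHn ?mulr0 ?oddB ?n_odd //; lia.
Qed.

(* The umbral substitution X^i -> E_i; the recurrence defining the Euler      *)
(* numbers says that it maps (X + 1)^n + (X - 1)^n to 2 0^n.                  *)
Section EulerUmbra.
Variables (R : comNzRingType) (m : nat).

(** The truncation at m makes this a finite sum; it is the true umbra only in degree at most m,
    whence the bounds [n <= m] below. *)
Definition euler_umbra (q : {poly R}) : R^o :=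
  \sum_(i < m.+1) q`_i * (euler i)%:~R.

Lemma euler_umbra_is_linear : linear euler_umbra.
Proof.
move=> a q r; rewrite /euler_umbra scaler_sumr -big_split; apply: eq_bigr => i _ /=.
by rewrite coefD coefZ mulrDl scalerAl.
Qed.

HB.instance Definition _ :=
  GRing.isLinear.Build R {poly R} R^o _ euler_umbra euler_umbra_is_linear.

Lemma euler_umbraXn n : (n <= m)%N -> euler_umbra 'X^n = (euler n)%:~R.
Proof.
rewrite -ltnS => nm; rewrite /euler_umbra (bigD1 (Ordinal nm)) //=.
rewrite coefXn eqxx mul1r big1 ?addr0 // => i; rewrite -val_eqE /= => /negPf ni.
by rewrite coefXn ni mul0r.
Qed.

Lemma euler_umbraXD n (c : R) : (n <= m)%N -> euler_umbra (('X + c%:P) ^+ n)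
  = \sum_(i < n.+1) ((euler (n - i))%:~R * c ^+ i) *+ 'C(n, i).
Proof.
move=> nm; rewrite exprDn linear_sum; apply: eq_bigr => i _ /=.
rewrite raddfMn /= -polyC_exp mulrC mul_polyC linearZ /= euler_umbraXn; last lia.
by rewrite mulrC.
Qed.

(** Odd powers of 1 and -1 cancel, even ones double, leaving twice the Euler recurrence. *)
Lemma euler_umbra_pm1 n : (n <= m)%N ->
  euler_umbra (('X + 1%:P) ^+ n) + euler_umbra (('X + (-1)%:P) ^+ n)
  = if n == 0%N then 2 else 0.
Proof.
move=> nm; rewrite !euler_umbraXD // -big_split /=.
case: eqP => [->|/eqP]; first by rewrite big_ord1 /= expr0 mulr1 euler0.
rewrite -lt0n => n0; transitivity (2 * ((\sum_(0 <= k < n.+1 | ~~ odd k)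
    'C(n, k)%:R * euler (n - k))%:~R : R)); last by rewrite euler_rec // mulr0.
rewrite big_mkord rmorph_sum mulr_sumr [RHS]big_mkcond /=; apply: eq_bigr => i _.
rewrite expr1n -signr_odd; case: odd => /=; rewrite ?expr0 ?expr1.
  by rewrite mulr1 mulrN1 mulNrn subrr.
by rewrite intrM rmorph_nat; ring.
Qed.

(** Expanding in powers of t reduces to [euler_umbra_pm1], which kills every term but t^m. *)
Lemma euler_umbra_shift (t : R) :
  euler_umbra (('X + (t + 1)%:P) ^+ m) + euler_umbra (('X + (t - 1)%:P) ^+ m)
  = 2 * t ^+ m.
Proof.
have shift c : euler_umbra (('X + (t + c)%:P) ^+ m)
    = \sum_(i < m.+1) t ^+ i * euler_umbra (('X + c%:P) ^+ (m - i)) *+ 'C(m, i).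
  rewrite polyCD addrA addrAC exprDn linear_sum.
  by apply: eq_bigr => i _ /=; rewrite raddfMn /= -polyC_exp mulrC mul_polyC linearZ.
rewrite !shift -big_split big_ord_recr /= big1 => [|i _]; last first.
  rewrite -mulrnDl -mulrDr euler_umbra_pm1; last lia.
  by rewrite subn_eq0 leqNgt ltn_ord /= mulr0 mul0rn.
by rewrite add0r -mulrnDl -mulrDr euler_umbra_pm1 subnn ?binn //= mulrC.
Qed.

(** Taking t = 2j in [euler_umbra_shift] makes the alternating sum telescope along odd arguments. *)
Lemma euler_umbra_alternating n :
  2 * \sum_(1 <= j < n.+1) (-1) ^+ j * ((j.*2)%:R : R) ^+ m
  = (-1) ^+ n * euler_umbra (('X + (n.*2.+1)%:R%:P) ^+ m)
    - euler_umbra (('X + 1%:P) ^+ m).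
Proof.
elim: n => [|n IHn]; first by rewrite big_geq // mulr0 mul1r subrr.
rewrite big_nat_recr // mulrDr IHn mulrCA -euler_umbra_shift.
rewrite (_ : n.+1.*2%:R - 1 = n.*2.+1%:R); last by rewrite doubleS -natr1 addrK.
rewrite (_ : n.+1.*2%:R + 1 = n.+1.*2.+1%:R); last by rewrite natr1.
rewrite exprS; ring.
Qed.

(** For m even the odd Euler numbers vanish, so the values at 1 and -1 agree, while their sum is
    0. *)
Lemma euler_umbra_at1 : ~~ odd m -> (0 < m)%N -> 2 * euler_umbra (('X + 1%:P) ^+ m) = 0.
Proof.
move=> m_even m0; have := euler_umbra_pm1 (leqnn m); rewrite -[_ == _]negbK -lt0n m0 /=.
suff -> : euler_umbra (('X + (-1)%:P) ^+ m) = euler_umbra (('X + 1%:P) ^+ m) by rewrite mulr_natl.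
rewrite !euler_umbraXD //; apply: eq_bigr => i _; rewrite expr1n -signr_odd.
have [i_odd|//] := boolP (odd i).
by rewrite euler_odd ?mul0r // oddB ?i_odd ?(negPf m_even) // -ltnS.
Qed.

End EulerUmbra.

(** * Euler numbers, the Legendre symbol of -1 and binomials modulo p *)

Section FpCongruences.
Variables (p : nat) (p_pr : prime p) (p_odd : odd p).
Local Notation N := (p./2).

Lemma alternating_sum_inv2_Fp : (3 < p)%N ->
  \sum_(1 <= j < N.+1) (-1) ^+ j / j%:R ^+ 2
  = 2 * (-1) ^+ N * (euler (p - 3))%:~R :> 'F_p.
Proof.
move=> p3; have two0 := Fp_2neq0 p_pr p_odd.
have := euler_umbra_alternating 'F_p (p - 3) N.
(* The upper end of the telescope is p = 0 in F_p, where the umbra of X^(p - 3) is E_(p-3). *)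
have -> : N.*2.+1 = p by lia.
rewrite pchar_Fp_0 // addr0 euler_umbraXn //.
have /eqP : 2 * euler_umbra (p - 3) (('X + 1%:P : {poly 'F_p}) ^+ (p - 3)) = 0.
  by apply: euler_umbra_at1; lia.
rewrite mulf_eq0 (negPf two0) => /eqP ->; rewrite subr0 => H.
rewrite -mulrA -H mulrA mulr_sumr; apply: eq_big_nat => j jN.
have /(natr_Fp_neq0 p_pr) j0 : (0 < j < p)%N by lia.
rewrite -mul2n natrM exprMn !Fp_expV2 //; field.
by rewrite j0 (natrM _ 2 2) mulf_neq0.
Qed.

Lemma legendreN1 : legendre (-1) p = (-1) ^+ N.
Proof.
have p1 := prime_gt1 p_pr.
rewrite /legendre ifF; last by apply/negbTE; rewrite dvdzE /= dvdn1; lia.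
have sq (b : 'F_p) : b ^+ 2 = -1 -> (-1) ^+ N = 1 :> 'F_p.
  move=> b2; have b0 : b != 0 by apply: contra_eq_neq b2 => ->; rewrite expr0n eq_sym oppr_eq0 oner_eq0.
  apply: (mulIf b0); rewrite -b2 -exprM -exprSr mul1r.
  rewrite (_ : (2 * N).+1 = p); last lia.
  by have := expf_card b; rewrite card_Fp.
case: ifP => [/existsP[b]|nb].
  rewrite eqz_mod_dvd => /dvdzP[c bc].
  have /sq : ((b : nat)%:R : 'F_p) ^+ 2 = -1.
    apply/eqP; rewrite -subr_eq0; apply/eqP.
    transitivity ((b%:Z ^+ 2 - -1)%:~R : 'F_p); first by rewrite rmorphB rmorphXn /= rmorphN.
    by rewrite bc rmorphM /= -[p%:~R]/(p%:R) pchar_Fp_0 // mulr0.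
  rewrite -(signr_odd 'F_p) -(signr_odd int); case: (odd N) => //=; rewrite expr1 => /eqP.
  by rewrite -subr_eq0 -opprD oppr_eq0 -[1 + 1]/2%:R (negPf (Fp_2neq0 p_pr p_odd)).
rewrite -signr_odd; case: (boolP (odd N)) => // N_even.
(* For N even, any x with x^N != 1 has x^N = -1, so x^(N/2) is a square root of -1. *)
have [|x x0 xN] := @finField_exp_neq1 'F_p N; first by rewrite card_Fp //; lia.
have xN2 : (x ^+ N) ^+ 2 = 1.
  apply: (mulIf x0); rewrite -exprM -exprSr mul1r (_ : (N * 2).+1 = p); last lia.
  by have := expf_card x; rewrite card_Fp.
move/eqP: xN2; rewrite sqrf_eq1 (negPf xN) /= => /eqP xN1.
case/negP: (negbT nb); apply/existsP; pose y := x ^+ N./2.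
have yp : ((y : nat) < p)%N by rewrite -[X in (_ < X)%N](Fp_cast p_pr) ltn_ord.
exists (Ordinal yp); rewrite eqz_mod_dvd.
rewrite (_ : _ - -1 = ((y : nat) ^ 2 + 1)%N%:Z); last by rewrite opprK PoszD -mulnn PoszM.
rewrite dvdzE /=.
rewrite -natr_Fp_eq0 // natrD natrX natr_Zp -exprM.
by rewrite (_ : (N./2 * 2)%N = N) ?xN1 ?addNr //; lia.
Qed.

Lemma bin_pred_Fp i : (i < p)%N -> 'C(p.-1, i)%:R = (-1) ^+ i :> 'F_p.
Proof.
elim: i => [|i IHi] ip; first by rewrite bin0.
have : 'C(p, i.+1)%:R = 0 :> 'F_p by apply/eqP; rewrite natr_Fp_eq0 // prime_dvd_bin.
rewrite (_ : 'C(p, _) = 'C(p.-1.+1, i.+1)); last by rewrite prednK ?prime_gt0.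
rewrite binS natrD IHi ?(ltnW ip) // => /eqP.
by rewrite addr_eq0 => /eqP ->; rewrite exprS mulN1r.
Qed.

Lemma bin_div_Fp i : (0 < i < p)%N ->
  ('C(p, i) %/ p)%:R = (-1) ^+ i.-1 / i%:R :> 'F_p.
Proof.
case: i => // i ip; have i0 := natr_Fp_neq0 p_pr ip.
apply: (mulIf i0); rewrite mulfVK // -bin_pred_Fp; last lia.
rewrite -natrM; congr (_%:R); apply/eqP; rewrite -(eqn_pmul2l (prime_gt0 p_pr)).
by rewrite mulnA (mulnC p) divnK ?prime_dvd_bin // mulnC mul_bin_diag.
Qed.

End FpCongruences.

(** * Sums of conjugate powers *)

Lemma rmorph_delannoy_poly (R S : pzRingType) (f : {rmorphism R -> S}) k (x : R) :
  f (delannoy_poly k x) = delannoy_poly k (f x).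
Proof.
rewrite rmorph_sum; apply: eq_bigr => j _.
by rewrite rmorphM rmorphXn rmorph_nat.
Qed.

Lemma sum_nat_double (V : nmodType) (f : nat -> V) n :
  \sum_(0 <= i < n.*2) f i = \sum_(0 <= j < n) (f j.*2 + f j.*2.+1).
Proof.
elim: n => [|n IHn]; first by rewrite !big_geq.
by rewrite doubleS !big_nat_recr //= IHn addrA.
Qed.

(** Odd powers of s cancel and even ones double with sign -1; the added 2 removes the constant
    term. *)
Lemma conj_pow_sum (R : comPzRingType) (s : R) n :
  (-1 + s) ^+ n.*2.+1 + (-1 - s) ^+ n.*2.+1 + 2
  = - 2 * \sum_(1 <= j < n.+1) 'C(n.*2.+1, j.*2)%:R * (s ^+ 2) ^+ j.
Proof.
rewrite !exprDn -big_split /=; pose f i := (-1) ^+ (n.*2.+1 - i) * s ^+ i *+ 'C(n.*2.+1, i)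
  + (-1) ^+ (n.*2.+1 - i) * (- s) ^+ i *+ 'C(n.*2.+1, i).
rewrite -(big_mkord xpredT f) -[n.*2.+2]/(n.+1.*2) sum_nat_double.
have step j : (0 <= j < n.+1)%N ->
    f j.*2 + f j.*2.+1 = - 2 * ('C(n.*2.+1, j.*2)%:R * (s ^+ 2) ^+ j).
  move=> /andP[_ jn]; rewrite /f -exprM mul2n !(exprNn s) -!(signr_odd _ (_ - _)).
  rewrite -(signr_odd _ j.*2) -(signr_odd _ j.*2.+1) !oddB; [|lia|lia].
  by rewrite /= !odd_double /= expr0 expr1; ring.
rewrite (eq_big_nat _ _ step) big_ltn // bin0 expr0 mulr1 mulr1 addrAC addNr add0r.
by rewrite mulr_sumr.
Qed.

(** The squares of -1 + s and -1 - s are -2s and 2s; the parity of n decides which power of s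
    survives. *)
Lemma gauss_pow_sum (R : comPzRingType) (s : R) n : s ^+ 2 = -1 ->
  (-1 + s) ^+ n.*2.+1 + (-1 - s) ^+ n.*2.+1 = - 2 * ((-1) ^+ uphalf n * 2 ^+ n).
Proof.
move=> s2; rewrite !exprS -mul2n !exprM.
have -> : (-1 + s) ^+ 2 = - (2 * s).
  by transitivity (1 + s ^+ 2 - 2 * s); [ring | rewrite s2; ring].
have -> : (-1 - s) ^+ 2 = 2 * s.
  by transitivity (1 + s ^+ 2 + 2 * s); [ring | rewrite s2; ring].
have sn : s ^+ n = (-1) ^+ n./2 * s ^+ odd n.
  by rewrite -{1}(odd_double_half n) exprD -mul2n exprM s2 mulrC.
rewrite (exprNn (2 * s)) exprMn -(signr_odd _ n) sn uphalf_half exprD.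
case: (odd n); rewrite /= ?expr0 ?expr1; last by ring.
by transitivity (- 2 * s ^+ 2 * ((-1) ^+ n./2 * 2 ^+ n)); [ring | rewrite s2; ring].
Qed.

(** * The three congruences in Z_p *)

Section PadicSums.
Variables (p : nat) (p_pr : prime p).
Local Notation Zp := (padic_int p_pr).

Lemma padic_natr_unit_lt k : (0 < k < p)%N -> (k%:R : Zp) \is a GRing.unit.
Proof. by move=> /andP[k0 kp]; rewrite padic_natr_unit // gtnNdvd. Qed.

Lemma tofrac_sum_div (f : nat -> Zp) e :
  \sum_(1 <= k < p) (f k)%:F / k%:R ^+ e = (\sum_(1 <= k < p) f k / k%:R ^+ e)%:F.
Proof.
rewrite rmorph_sum; apply: eq_big_nat => k /padic_natr_unit_lt ku.
by rewrite rmorphM rmorphV ?unitrX // rmorphXn rmorph_nat.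
Qed.

Lemma padic_red_sum_div (f : nat -> Zp) e :
  padic_red (\sum_(1 <= k < p) f k / k%:R ^+ e)
  = \sum_(1 <= k < p) padic_red (f k) / k%:R ^+ e.
Proof.
rewrite rmorph_sum; apply: eq_big_nat => k /padic_natr_unit_lt ku.
by rewrite rmorphM rmorphV ?unitrX // rmorphXn rmorph_nat.
Qed.

Hypothesis p_odd : odd p.

Lemma padic_frac_p_neq0 : (p%:R : padic_num p_pr) != 0.
Proof. by rewrite -(rmorph_nat (@FracField.tofrac Zp)) tofrac_eq0 padic_p_neq0. Qed.

Lemma delannoy_sum_inv (x : Zp) (L : fieldType) (iota : {rmorphism padic_num p_pr -> L}) (s : L) :
  s ^+ 2 = - iota (x%:F) ->
  exists2 y : padic_num p_pr,
    iota y = ((-1 + s) ^+ p + (-1 - s) ^+ p + 2) / p%:R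
  & padic_eqmod p_pr (\sum_(1 <= k < p) delannoy_poly k (x%:F) / k%:R) y.
Proof.
move=> s2; have pE : p = (p./2).*2.+1 by lia.
(* Dividing the binomials by p in the naturals shows that y is a p-adic integer, free of s. *)
exists (- 2 * \sum_(1 <= j < (p./2).+1) ('C(p, j.*2) %/ p)%:R * (- x) ^+ j)%:F.
  have p0 : (p%:R : L) != 0 by rewrite -(rmorph_nat iota) fmorph_eq0 padic_frac_p_neq0.
  apply: (mulIf p0); rewrite mulfVK //.
  have := conj_pow_sum s p./2; rewrite -pE s2 => ->.
  rewrite !rmorphM /= !rmorphN !rmorph_nat !rmorph_sum -mulrA mulr_suml; congr (_ * _).
  apply: eq_big_nat => j jN; rewrite !rmorphM !rmorph_nat !rmorphXn !rmorphN mulrAC /=.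
  by rewrite -natrM divnK // prime_dvd_bin //; lia.
have -> : \sum_(1 <= k < p) delannoy_poly k x%:F / k%:R
    = \sum_(1 <= k < p) (delannoy_poly k x)%:F / k%:R ^+ 1.
  by apply: eq_bigr => k _; rewrite rmorph_delannoy_poly.
rewrite tofrac_sum_div; apply: padic_eqmod_red; rewrite padic_red_sum_div.
under eq_bigr do rewrite rmorph_delannoy_poly expr1.
rewrite sum_delannoy_div_Fp // rmorphM rmorphN rmorph_nat rmorph_sum mulr_sumr.
apply: eq_big_nat => j jN; rewrite rmorphM rmorph_nat rmorphXn rmorphN /=.
have /(natr_Fp_neq0 p_pr) j0 : (0 < j < p)%N by lia.
rewrite bin_div_Fp //; last lia.
rewrite -signr_odd (_ : odd _ = true); last lia.
by rewrite -muln2 natrM; field; rewrite j0 Fp_2neq0.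
Qed.

Lemma delannoy_sum_inv1 :
  padic_eqmod p_pr (\sum_(1 <= k < p) (delannoy k)%:R / k%:R)
    (- ((2 ^+ (p - 1) - 1) / p%:R)).
Proof.
have [L [iota [s s2]]] := sqrt_extension (- 1 : padic_num p_pr).
have s2' : s ^+ 2 = - iota ((1 : Zp)%:F) by rewrite s2 tofrac1 rmorphN.
have [y iy [u [v [w [Su yv uvw]]]]] := delannoy_sum_inv s2'.
have pE : p = (p./2).*2.+1 by lia.
pose e : Zp := (-1) ^+ uphalf p./2 * 2 ^+ p./2.
have e2 : e ^+ 2 = 2 ^+ (p - 1).
  rewrite exprMn -!exprM mulnC exprM sqrrN expr1n expr1n mul1r; congr (_ ^+ _); lia.
have p0 : (p%:R : L) != 0 by rewrite -(rmorph_nat iota) fmorph_eq0 padic_frac_p_neq0.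
(* An identity in Z_p, checked in L because both embeddings are injective. *)
have pv : v * p%:R = 2 - 2 * e.
  apply/eqP; rewrite -tofrac_eq; apply/eqP; rewrite [LHS]rmorphM /= -yv rmorph_nat; apply: (fmorph_inj iota).
  rewrite rmorphM iy rmorph_nat mulfVK //.
  have sN1 : s ^+ 2 = -1 by rewrite s2 rmorphN rmorph1.
  have := gauss_pow_sum p./2 sN1; rewrite -pE => ->.
  rewrite !rmorphB !rmorphM !rmorphXn !rmorphN !rmorph1 !rmorph_nat; ring.
have h2 : (2 : Zp) * 2^-1 = 1.
  by apply: divrr; apply: padic_natr_unit_lt; have := prime_gt1 p_pr; lia.
set h := 2^-1 in h2.
(* Since e = 1 - p v h with h = 1/2, the second witness is exactly -(e^2 - 1)/p. *)
exists u, (v - p%:R * (v * h) ^+ 2), (w + (v * h) ^+ 2); split.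
- by rewrite -Su; apply: eq_bigr => k _; rewrite rmorph1 delannoy_natr.
- apply: (mulIf padic_frac_p_neq0); rewrite mulNr mulfVK ?padic_frac_p_neq0 //.
  rewrite -(rmorph_nat (@FracField.tofrac Zp) 2) -(rmorph_nat (@FracField.tofrac Zp) p).
  rewrite -rmorphXn -(rmorph1 (@FracField.tofrac Zp)) -rmorphB -rmorphN -rmorphM.
  congr (_%:F); rewrite -e2.
  have eE : e = 1 - p%:R * v * h.
    have -> : p%:R * v * h = h * (v * p%:R) by ring.
    by rewrite pv; transitivity (1 - (2 * h) + (2 * h) * e); [rewrite h2 | ]; ring.
  rewrite eE; transitivity ((2 * h) * (v * p%:R) - p%:R ^+ 2 * (v * h) ^+ 2); last rewrite h2; ring.
- by rewrite opprB addrA addrAC uvw; ring.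
Qed.

Lemma delannoy_sum_inv2 :
  padic_eqmod p_pr
    (\sum_(1 <= k < p) (delannoy k)%:R / k%:R ^+ 2)
    (2 * (legendre (-1) p)%:~R * (euler (p - 3))%:~R).
Proof.
have -> : 2 * (legendre (-1) p)%:~R * (euler (p - 3))%:~R
    = (2 * (legendre (-1) p)%:~R * (euler (p - 3))%:~R : Zp)%:F.
  by rewrite !rmorphM !rmorph_int rmorph_nat.
have -> : \sum_(1 <= k < p) (delannoy k)%:R / k%:R ^+ 2
    = \sum_(1 <= k < p) ((delannoy k)%:R : Zp)%:F / k%:R ^+ 2.
  by apply: eq_bigr => k _; rewrite rmorph_nat.
rewrite tofrac_sum_div; apply: padic_eqmod_red; rewrite padic_red_sum_div.
rewrite !rmorphM !rmorph_int rmorph_nat.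
under eq_bigr do rewrite rmorph_nat.
rewrite legendreN1 // rmorphXn rmorphN rmorph1.
have [p3|p3] := ltnP 3 p.
  by rewrite sum_delannoy_div2_Fp // alternating_sum_inv2_Fp.
(* For p = 3 both sides are 1: 3 + 13/4 on the left, 2 (-1) E_0 = -2 on the right. *)
have {p3} pE : p = 3 by have := prime_gt1 p_pr; lia.
move: p_pr; rewrite pE => ?.
have [d1 d2] : delannoy 1 = 3 /\ delannoy 2 = 13 by rewrite /delannoy unlock.
by rewrite big_ltn // big_nat1 d1 d2; apply/eqP; vm_compute.
Qed.

End PadicSums.

Theorem theorem1p1 (p : nat) (p_pr : prime p) (p_odd : odd p) :
  [/\ padic_eqmod p_pr
        (\sum_(1 <= k < p) (delannoy k)%:R / k%:R ^+ 2)
        (2 * (legendre (-1) p)%:~R * (euler (p - 3))%:~R),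
      padic_eqmod p_pr
        (\sum_(1 <= k < p) (delannoy k)%:R / k%:R)
        (- ((2 ^+ (p - 1) - 1) / p%:R))
    & forall (x : padic_int p_pr)
             (L : fieldType) (iota : {rmorphism padic_num p_pr -> L}) (s : L),
        s ^+ 2 = - iota (x%:F) ->
        exists2 y : padic_num p_pr,
          iota y = ((-1 + s) ^+ p + (-1 - s) ^+ p + 2) / p%:R
        & padic_eqmod p_pr (\sum_(1 <= k < p) delannoy_poly k (x%:F) / k%:R) y].
Proof.
split; [exact: delannoy_sum_inv2 | exact: delannoy_sum_inv1 |].
by move=> x L iota s; apply: delannoy_sum_inv.
Qed.
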